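(* Consider the two-player nonzero-sum stochastic differential game driven by the controlled Markov regime-switching jump-diffusion $Y=Y^{u_1,u_2}$ with $Y(0)=y$, $\alpha(0)=e_i$, as described in the context. Let $A_1,A_2\subseteq\mathbb{R}$. For $k=1,2$ and $\lambda_k\in A_k$ put $$J_k^{\lambda_k}(y,e_i,u_1,u_2)=E^{y,e_i}\Big[\int_0^T f_k(t,Y(t),\alpha(t),u_1(t),u_2(t))\,dt+g_k(Y^{u_1,u_2}(T),\alpha(T))+\lambda_k M_k(Y^{u_1,u_2}(T),\alpha(T))\Big].$$ Suppose that for all $\lambda_1\in A_1$, $\lambda_2\in A_2$ there is a Nash equilibrium $(u_1^{*,\lambda_1},u_2^{*,\lambda_2})\in\Theta_1\times\Theta_2$ of the unconstrained game with functionals $J_1^{\lambda_1},J_2^{\lambda_2}$, with values $$\phi_k^{\lambda_k}(y,e_i)=J_k^{\lambda_k}(y,e_i,u_1^{*,\lambda_1},u_2^{*,\lambda_2}),\qquad k=1,2,\ i=1,\dots,D.$$ Suppose moreover that there exist $\lambda_1^0\in A_1$ and $\lambda_2^0\in A_2$ such that, for all $\lambda_1\in A_1$, $\lambda_2\in A_2$, $$E^{y,e_i}\big[M_1\big(Y^{u_1^{*,\lambda_1^0},u_2^{*,\lambda_2}}(T),\alpha(T)\big)\big]=0\quad\text{and}\quad E^{y,e_i}\big[M_2\big(Y^{u_1^{*,\lambda_1},u_2^{*,\lambda_2^0}}(T),\alpha(T)\big)\big]=0,$$ for all $e_i\in S$, $i=1,\dots,D$ (and all initial values $y$ considered). Then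 $(u_1^*,u_2^* )=(u_1^{*,\lambda_1^0},u_2^{*,\lambda_2^0})$ solves the constrained nonzero-sum game (in the sense defined in the context) with functionals $$J_k(y,e_i,u_1,u_2)=E^{y,e_i}\Big[\int_0^T f_k(t,Y(t),\alpha(t),u_1(t),u_2(t))\,dt+g_k(Y^{u_1,u_2}(T),\alpha(T))\Big],\quad k=1,2,$$ and constraints $E^{y,e_i}[M_k(Y^{u_1,u_2}(T),\alpha(T))]=0$, $k=1,2$, and its values satisfy $\phi_k(y,e_i)=\phi_k^{\lambda_k^0}(y,e_i)$ for $k=1,2$, $i=1,\dots,D$, where $\phi_k^{\lambda_k^0}$ is the value for the pair of multipliers $(\lambda_1^0,\lambda_2^0)$.
   Context: Probabilistic setting. $T>0$ is finite and $(\Omega,\mathbb{F},(\mathcal{F}_t)_{t\ge0},\mathbb{P})$ is a complete probability space whose right-continuous, $\mathbb{P}$-completed filtration is generated by mutually independent processes: an $M$-dimensional Brownian motion $W$ (this integer $M$ is unrelated to the constraint functions $M_k$), an $L$-dimensional Poisson random measure $N=(N_1,\dots,N_L)$ on $[0,T]\times\mathbb{R}_0$, $\mathbb{R}_0=\mathbb{R}\setminus\{0\}$, and a continuous-time Markov chain $\alpha$ with state space $S=\{e_1,\dots,e_D\}$, the standard basis of $\mathbb{R}^D$, with transition intensities $\mu_{ij}(t)$ ($\mu_{ij}\ge0$ for $i\ne j$, $\sum_j\mu_{ij}=0$). $\tilde N_\alpha=(\tilde N_1,\dots,\tilde N_L)$ denotes the compensated Poisson random measures, $\tilde N_l(dt,dz)=N_l(dt,dz)-\nu^l_{\alpha(t-)}(dz)\,dt$,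 with Lévy measures $\nu^l_{e_i}$ depending on the regime. $\tilde\Phi=(\tilde\Phi_1,\dots,\tilde\Phi_D)^T$, where $\tilde\Phi_j(t)=\Phi_j(t)-\int_0^t\mu_j(s)\,ds$ is a martingale, $\Phi_j(t)$ is the number of jumps of $\alpha$ into $e_j$ up to time $t$, and $\mu_j(s)=\sum_{i\ne j}\mu_{ij}(s)\langle\alpha(s-),e_i\rangle$. State process. For controls $u_1,u_2$, $$dY(t)=b(t,Y(t),\alpha(t),u_1(t),u_2(t))dt+\sigma(t,Y(t),\alpha(t),u_1(t),u_2(t))dW(t)$$ $$+\int_{\mathbb{R}_0}\eta(t,Y(t-),\alpha(t-),u_1(t-),u_2(t-),z)\tilde N_\alpha(dt,dz)+\gamma(t,Y(t-),\alpha(t-),u_1(t-),u_2(t-))d\tilde\Phi(t),$$ $Y(0)=y$, with measurable $b,\sigma,\eta,\gamma$ with values in $\mathbb{R}^N,\mathbb{R}^{N\times M},\mathbb{R}^{N\times L},\mathbb{R}^{N\times D}$ satisfying $\int_0^T\{|b|+|\sigma|^2+\int_{\mathbb{R}_0}|\eta|^2\nu(dz)+\sum_{j=1}^D|\gamma|^2\mu_j(t)\}dt<\infty$ along the solution. The initial value $y$ ranges over $G$, an open subset of $\mathbb{R}^N$ (solvency region). $E^{y,e_i}$ is expectation given $Y(0)=y$, $\alpha(0)=e_i$. Controls. $\mathcal{U}_1,\mathcal{U}_2\subset\mathbb{R}^N$ are non-empty. $\Theta_1,\Theta_2$ are given families of admissible controls: $u_k$ is $\mathcal{U}_k$-valued,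 $\mathcal{F}_t$-predictable, càdlàg, $E[\int_0^T|u_k|^2dt]<\infty$, and for every $(u_1,u_2)\in\Theta_1\times\Theta_2$ the state equation has a unique strong solution and $E[\int_0^T|f_k(t,Y(t),\alpha(t),u_1(t),u_2(t))|dt+|g_k(Y(T),\alpha(T))|]<\infty$, $k=1,2$. Here $f_k:[0,T]\times\mathbb{R}^N\times S\times\mathcal{U}_1\times\mathcal{U}_2\to\mathbb{R}$, $g_k:\mathbb{R}^N\times S\to\mathbb{R}$ and $M_k:\mathbb{R}^N\times S\to\mathbb{R}$ are $C^1$ in $y$, and $E[M_k(Y^{u_1,u_2}(T),\alpha(T))]<\infty$. Expectations appearing in the functionals and constraints are assumed well defined. Nash equilibrium (unconstrained). $(u_1^*,u_2^* )\in\Theta_1\times\Theta_2$ is a Nash equilibrium for functionals $\mathcal J_1,\mathcal J_2$ if $\mathcal J_1(y,e_i,u_1,u_2^* )\le\mathcal J_1(y,e_i,u_1^*,u_2^* )$ for all $u_1\in\Theta_1$ and $\mathcal J_2(y,e_i,u_1^*,u_2)\le\mathcal J_2(y,e_i,u_1^*,u_2^* )$ for all $u_2\in\Theta_2$, for all $e_i\in S$, $y\in G$. Solution of the constrained game. $(u_1^*,u_2^* )\in\Theta_1\times\Theta_2$ solves the constrained game, with values $\phi_k(y,e_i)$, if it satisfies both constraints and, for all $e_i\in S$, $y\in G$, $$\phi_1(y,e_i)=J_1(y,e_i,u_1^*,u_2^* )=\sup_{u_1}J_1(y,e_i,u_1,u_2^* ),\qquad \phi_2(y,e_i)=J_2(y,e_i,u_1^*,u_2^*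 )=\sup_{u_2}J_2(y,e_i,u_1^*,u_2),$$ where the first supremum is over $u_1\in\Theta_1$ such that $(u_1,u_2^* )$ satisfies the constraint with $k=1$, and the second over $u_2\in\Theta_2$ such that $(u_1^*,u_2)$ satisfies the constraint with $k=2$. *)

(* Defs.v *)
From HB Require Import structures.
From mathcomp Require Import all_boot all_order all_algebra.
From mathcomp Require Import all_classical all_reals all_analysis.
From mathcomp Require Import measurable_realfun.

Set Implicit Arguments.
Unset Strict Implicit.
Unset Printing Implicit Defensive.

Import Order.TTheory GRing.Theory Num.Theory.
Import numFieldNormedType.Exports.

Local Open Scope classical_set_scope.
Local Open Scope ring_scope.

(* Conventions.  Time is a real number; processes are functions of (t, w) on
   the whole real line, of which only t >= 0 (or t in [0, T]) is relevant.
   The state e_i of the Markov chain, the i-th vector of the standard basis of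
   R^D, is encoded by its index i : 'I_D, so <alpha, e_i> is the indicator of
   alpha = i.  Vectors of R^N are rows 'rV[R]_N. *)

Definition sqnorm (R : realType) m n (A : 'M[R]_(m, n)) : R :=
  \sum_(i < m) \sum_(j < n) A i j ^+ 2.

(* Borel measurability of h on D, for the trace on D of the Borel sets. *)
Definition borel_on (X Z : topologicalType) (D : set X) (h : X -> Z) : Prop :=
  forall O : set Z, open O ->
    exists2 B : set X, <<s [set V : set X | open V] >> B &
      D `&` h @^-1` O = D `&` B.

Definition class_C1 (R : realType) N (h : 'rV[R]_N -> R) : Prop :=
  (forall y, differentiable h y) /\
  (forall v, continuous (fun y => 'D_v h y)).

Section noise.
Context {d : measure_display} {Omega : measurableType d} {R : realType}.
Variables (P : probability Omega R) (T : R) (M L D : nat).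

Local Notation leb := (@lebesgue_measure R).

(* Driving noises: Brownian motion W, random measures N_l, chain alpha;
   and their characteristics: intensities mu_ij(t), Levy measures nu^l_{e_i}. *)
Record noise := Noise {
  bm : 'I_M -> R -> Omega -> R ;
  prm : 'I_L -> Omega ->
    {measure set (R * R)%type -> \bar R} ;
  chain : R -> Omega -> 'I_D ;
  rate : 'I_D -> 'I_D -> R -> R ;
  levy : 'I_L -> 'I_D -> {measure set R -> \bar R}
}.

Variable X : noise.

(* alpha(s-); the default value is used only where there is no left limit *)
Definition chain_left (s : R) (w : Omega) : 'I_D :=
  xget (chain X s w) [set i | \forall r \near s^'-, chain X r w = i].

(* mu_j(s) = sum_(i != j) mu_ij(s) <alpha(s-), e_i> *)
Definition chain_rate (j : 'I_D) (s : R) (w : Omega) : R :=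
  \sum_(i < D | i != j) rate X i j s * (chain_left s w == i)%:R.

Definition chain_events (s : R) : set (set Omega) :=
  [set E | exists r i, 0 <= r <= s /\ E = [set w | chain X r w = i]].

Definition prm_events (s : R) : set (set Omega) :=
  [set E | exists l (B : set (R * R)) (c : nat),
     [/\ measurable B, B `<=` `[0, s] `*` setT &
         E = [set w | prm X l w B = c%:R%:E]]].

Definition bm_events (s : R) : set (set Omega) :=
  [set E | exists m r (C : set R),
     [/\ 0 <= r <= s, measurable C & E = [set w | C (bm X m r w)]]].

Definition raw_filtration (s : R) : set (set Omega) :=
  <<s bm_events s `|` prm_events s `|` chain_events s `|` P.-negligible >>.

Definition filtration (t : R) : set (set Omega) :=
  \bigcap_(s in [set s | t < s]) raw_filtration s.

Definition sigma_chain : set (set Omega) :=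
  <<s \bigcup_(s in [set s | 0 <= s]) chain_events s >>.

Definition sigma_prm_chain : set (set Omega) :=
  <<s \bigcup_(s in [set s | 0 <= s]) (prm_events s `|` chain_events s) >>.

Definition adapted_measurable (t : R) (xi : Omega -> R) : Prop :=
  forall C : set R, measurable C ->
    filtration t (xi @^-1` C).

(* M-dimensional Brownian motion, independent of (N, alpha): increments over
   disjoint intervals and of different components are independent centred
   Gaussian variables, jointly independent of sigma(N, alpha). *)
Definition is_brownian : Prop :=
  [/\ forall m t, measurable_fun setT (bm X m t),
      {ae P, forall w, forall m, bm X m 0 w = 0},
      forall m w, {within `[0, +oo[, continuous (bm X m ^~ w)} &
      forall (n : nat) (t : nat -> R) (A : set Omega)
             (B : 'I_M -> 'I_n -> set R),
        0 <= t 0%N -> (forall k, t k < t k.+1) ->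
        sigma_prm_chain A -> (forall m k, measurable (B m k)) ->
        fine (P [set w | A w /\ forall m (k : 'I_n),
                  B m k (bm X m (t k.+1) w - bm X m (t k) w)]) =
        fine (P A) * \prod_(m < M) \prod_(k < n)
          fine (normal_prob 0 (Num.sqrt (t k.+1 - t k)) (B m k))].

(* Time-inhomogeneous Markov chain with intensities mu_ij(t): its transition
   probabilities p_ij(s, t) solve Kolmogorov's forward equation in integral
   form. *)
Definition is_markov_chain : Prop :=
  [/\ forall t i, measurable [set w | chain X t w = i],
      forall t w, 0 <= t -> \forall r \near t^'+, chain X r w = chain X t w,
      forall t w, 0 < t -> exists i, \forall r \near t^'-, chain X r w = i,
      [/\ forall i j t, i != j -> 0 <= t -> 0 <= rate X i j t,
          forall i t, 0 <= t -> \sum_(j < D) rate X i j t = 0 &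
          forall i j t, leb.-integrable `[0, t] (EFin \o rate X i j)] &
      exists p : R -> R -> 'I_D -> 'I_D -> R,
        [/\ forall s t i j, 0 <= s <= t -> 0 <= p s t i j <= 1,
            forall (s : R) i j, 0 <= s ->
              measurable_fun `[s, +oo[ (fun t : R => p s t i j),
            forall s t i j, 0 <= s <= t ->
              p s t i j = (i == j)%:R +
                \int[leb]_(r in `[s, t]) (\sum_(k < D) p s r i k * rate X k j r) &
            forall (n : nat) (t : nat -> R) (i : nat -> 'I_D),
              0 <= t 0%N -> (forall k, t k <= t k.+1) ->
              fine (P [set w | forall k, (k <= n)%N -> chain X (t k) w = i k]) =
              fine (P [set w | chain X (t 0%N) w = i 0%N]) *
                \prod_(k < n) p (t k) (t k.+1) (i k) (i k.+1)]].

Definition is_levy_measure (nu : {measure set R -> \bar R}) :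
    Prop :=
  nu [set 0] = 0%E /\ (\int[nu]_z (Num.min 1 (z ^+ 2))%:E < +oo)%E.

(* The compensating measure of N_l, evaluated at B:
   int_0^T nu^l_{alpha(s-)}({z | (s, z) in B}) ds. *)
Definition intensity (l : 'I_L)
    (B : set (R * R)) (w : Omega) : \bar R :=
  (\int[leb]_(s in `[0%R, T]) levy X l (chain_left s w) (xsection B s))%E.

(* Poisson probability of c at rate r >= 0, including r = 0. *)
Definition poisson_weight (r : R) (c : nat) : R :=
  r ^+ c / c`!%:R * expR (- r).

(* Since the compensator nu^l_{alpha(t-)}(dz) dt of N_l depends on the regime,
   the independence of N and alpha is understood conditionally: given alpha,
   N_1, ..., N_L are independent Poisson random measures with intensities
   nu^l_{alpha(s-)}(dz) ds.  When nu^l_{e_i} does not depend on i, this says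
   that N_1, ..., N_L, alpha are mutually independent. *)
Definition is_prm : Prop :=
  [/\ forall l i, is_levy_measure (levy X l i),
      forall l B, measurable B -> measurable_fun setT ((fun w => prm X l w B) : Omega -> \bar R),
      forall l w B, measurable B ->
        prm X l w B = +oo%E \/ exists c : nat, prm X l w B = c%:R%:E,
      forall l w, prm X l w (~` (`[0, T] `*` [set~ 0])) = 0%E &
      forall (n : nat) (l : 'I_n -> 'I_L)
             (B : 'I_n -> set (R * R))
             (c : 'I_n -> nat) (A : set Omega),
        (forall k, [/\ measurable (B k), B k `<=` `[0, T] `*` [set~ 0] &
           forall i, (\int[leb]_(s in `[0%R, T])
                        levy X (l k) i (xsection (B k) s) < +oo)%E]) ->
        (forall j k, j != k -> l j = l k -> B j `&` B k = set0) ->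
        sigma_chain A ->
        P [set w | A w /\ forall k, prm X (l k) w (B k) = (c k)%:R%:E] =
        (\int[P]_(w in A)
          (\prod_(k < n) poisson_weight (fine (intensity (l k) (B k) w)) (c k))%:E)%E].

(* The last condition makes the conditioning on alpha(0) = e_i in E^{y,e_i}
   meaningful for every state e_i. *)
Definition is_noise : Prop :=
  [/\ measure_is_complete P, is_brownian, is_prm, is_markov_chain &
      forall i, (0 < P [set w | chain X 0 w = i])%E].

(* Ito integrals over [0, t] are limits in probability of integrals of
   elementary predictable integrands h_n such that
   int_0^t |h_n - H|^2 ds --> 0 in probability. *)

Definition cvg_to0_in_probability (Z : nat -> Omega -> \bar R) : Prop :=
  forall e : R, 0 < e ->
    (fun n => P [set w | (e%:E < Z n w)%E]) @ \oo --> 0%E.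

(* the elementary process xi * 1_]a, b] *)
Record step := Step {
  step_from : R ;
  step_to : R ;
  step_coef : Omega -> R
}.

Definition step_wf (h : step) : Prop :=
  [/\ 0 <= step_from h <= step_to h,
      exists K, forall w, `|step_coef h w| <= K &
      adapted_measurable (step_from h) (step_coef h)].

Definition step_val (h : step) (s : R) (w : Omega) : R :=
  step_coef h w * (step_from h < s <= step_to h)%R%:R.

Definition is_bm_integral (m : 'I_M) (H : R -> Omega -> R) (t : R)
    (xi : Omega -> R) : Prop :=
  measurable_fun setT xi /\
  exists (q : nat -> nat) (h : nat -> nat -> step),
    [/\ forall n k, step_wf (h n k),
        cvg_to0_in_probability (fun n w =>
          \int[leb]_(s in `[0%R, t])
            ((\sum_(k < q n) step_val (h n k) s w - H s w) ^+ 2)%:E)%E &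
        cvg_to0_in_probability (fun n w =>
          `|\sum_(k < q n) step_coef (h n k) w *
               (bm X m (Num.min (step_to (h n k)) t) w -
                bm X m (Num.min (step_from (h n k)) t) w) - xi w|%:E)].

(* tilde N_l (B) = N_l(B) - int int_B nu^l_{alpha(s-)}(dz) ds *)
Definition compensated_prm (l : 'I_L)
    (B : set (R * R)) (w : Omega) : R :=
  fine (prm X l w B) - fine (intensity l B w).

(* integrands are sums of xi(w) 1_]a, b](s) 1_A(z) *)
Definition jump_step_wf (l : 'I_L) (h : step * set R) : Prop :=
  [/\ step_wf h.1, measurable h.2, h.2 `<=` [set~ 0] &
      forall i, (levy X l i h.2 < +oo)%E].

Definition is_prm_integral (l : 'I_L) (H : R -> Omega -> R -> R) (t : R)
    (xi : Omega -> R) : Prop :=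
  measurable_fun setT xi /\
  exists (q : nat -> nat) (h : nat -> nat -> step * set R),
    [/\ forall n k, jump_step_wf l (h n k),
        cvg_to0_in_probability (fun n w =>
          \int[leb]_(s in `[0%R, t])
            \int[levy X l (chain_left s w)]_(z in [set~ 0%R])
              ((\sum_(k < q n) step_val (h n k).1 s w * \1_((h n k).2) z
                - H s w z) ^+ 2)%:E)%E &
        cvg_to0_in_probability (fun n w =>
          `|\sum_(k < q n) step_coef (h n k).1 w *
               compensated_prm l
                 (`]Num.min (step_from (h n k).1) t, Num.min (step_to (h n k).1) t]
                    `*` (h n k).2) w - xi w|%:E)].

(* jump times of alpha into e_j up to time t; Phi_j(t) is their number *)
Definition jumps_into (j : 'I_D) (t : R) (w : Omega) : set R :=
  [set s | [/\ 0 < s <= t, chain_left s w != j & chain X s w = j]].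

(* int_0^t H d(tilde Phi_j): tilde Phi_j has paths of finite variation, and
   the integral is a pathwise Stieltjes integral. *)
Definition chain_integral (j : 'I_D) (H : R -> Omega -> R) (t : R) (w : Omega) :
    R :=
  \sum_(s \in jumps_into j t w) H s w -
  \int[leb]_(s in `[0, t]) (H s w * chain_rate j s w).

Variable N : nat.

Local Notation process := (R -> Omega -> 'rV[R]_N).

Definition cadlag (Z : process) : Prop :=
  forall w,
    (forall t, 0 <= t < T -> Z r w @[r --> t^'+] --> Z t w) /\
    (forall t, 0 < t <= T -> cvg (Z r w @[r --> t^'-])).

Definition left_limit (Z : process) (t : R) (w : Omega) : 'rV[R]_N :=
  lim (Z r w @[r --> t^'-]).

Definition adapted (Z : process) : Prop :=
  forall t k, 0 <= t <= T -> adapted_measurable t (fun w => Z t w 0 k).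

Definition predictable_sets : set (set (R * Omega)) :=
  <<s `[0, T] `*` setT,
    [set E | exists A, filtration 0 A /\ E = [set 0] `*` A] `|`
    [set E | exists s t A,
       [/\ 0 <= s <= t, t <= T, filtration s A & E = `]s, t] `*` A]] >>.

Definition predictable (Z : process) : Prop :=
  forall k (C : set R), measurable C ->
    predictable_sets
      ((`[0, T] `*` setT) `&` [set x : R * Omega | C (Z x.1 x.2 0 k)]).

Definition admissible_control (U : set 'rV[R]_N) (u : process) : Prop :=
  [/\ forall t w, 0 <= t <= T -> U (u t w),
      predictable u,
      cadlag u &
      (\int[P]_w \int[leb]_(t in `[0%R, T]) (sqnorm (u t w))%:E < +oo)%E].

Record dynamics := Dynamics {
  drift : R -> 'rV[R]_N -> 'I_D -> 'rV[R]_N -> 'rV[R]_N -> 'rV[R]_N ;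
  diffusion : R -> 'rV[R]_N -> 'I_D -> 'rV[R]_N -> 'rV[R]_N -> 'M[R]_(N, M) ;
  jump : R -> 'rV[R]_N -> 'I_D -> 'rV[R]_N -> 'rV[R]_N -> R -> 'M[R]_(N, L) ;
  regime_jump : R -> 'rV[R]_N -> 'I_D -> 'rV[R]_N -> 'rV[R]_N -> 'M[R]_(N, D)
}.

Definition measurable_dynamics (U1 U2 : set 'rV[R]_N) (S : dynamics) : Prop :=
  let dom := [set x : R * 'rV[R]_N * 'rV[R]_N * 'rV[R]_N |
                [/\ 0 <= x.1.1.1 <= T, U1 x.1.2 & U2 x.2]] in
  forall i,
    [/\ borel_on dom (fun x => drift S x.1.1.1 x.1.1.2 i x.1.2 x.2),
        borel_on dom (fun x => diffusion S x.1.1.1 x.1.1.2 i x.1.2 x.2),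
        borel_on (dom `*` [set~ (0 : R)])
          (fun x => jump S x.1.1.1.1 x.1.1.1.2 i x.1.1.2 x.1.2 x.2) &
        borel_on dom (fun x => regime_jump S x.1.1.1 x.1.1.2 i x.1.2 x.2)].

Section state_equation.
Variables (S : dynamics) (u1 u2 : process) (y : 'rV[R]_N) (Y : process).

Let b t w := drift S t (Y t w) (chain X t w) (u1 t w) (u2 t w).
Let sigma t w := diffusion S t (Y t w) (chain X t w) (u1 t w) (u2 t w).
Let eta t w z := jump S t (left_limit Y t w) (chain_left t w)
  (left_limit u1 t w) (left_limit u2 t w) z.
Let gamma t w := regime_jump S t (left_limit Y t w) (chain_left t w)
  (left_limit u1 t w) (left_limit u2 t w).

Definition coefficients_integrable : Prop :=
  {ae P, forall w, (\int[leb]_(t in `[0%R, T])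
    ((Num.sqrt (sqnorm (b t w)))%:E + (sqnorm (sigma t w))%:E
     + \sum_(l < L) \int[levy X l (chain_left t w)]_(z in [set~ 0%R])
         (sqnorm (col l (eta t w z)))%:E
     + \sum_(j < D) (sqnorm (col j (gamma t w)) * chain_rate j t w)%:E)
    < +oo)%E}.

Definition state_equation : Prop :=
  forall t, 0 <= t <= T ->
    exists (IW : 'I_N -> 'I_M -> Omega -> R) (IN : 'I_N -> 'I_L -> Omega -> R),
      [/\ forall k m, is_bm_integral m (fun s w => sigma s w k m) t (IW k m),
          forall k l, is_prm_integral l (fun s w z => eta s w z k l) t (IN k l) &
          {ae P, forall w, forall k,
             Y t w 0 k = y 0 k + \int[leb]_(s in `[0, t]) (b s w 0 k)
               + \sum_(m < M) IW k m w + \sum_(l < L) IN k l w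
               + \sum_(j < D) chain_integral j (fun s w => gamma s w k j) t w}].

Definition strong_solution : Prop :=
  [/\ adapted Y, cadlag Y, {ae P, forall w, Y 0 w = y},
      coefficients_integrable & state_equation].

End state_equation.

Definition unique_strong_solution (S : dynamics) (u1 u2 : process)
    (y : 'rV[R]_N) (Y : process) : Prop :=
  strong_solution S u1 u2 y Y /\
  forall Z, strong_solution S u1 u2 y Z ->
    {ae P, forall w, forall t, 0 <= t <= T -> Z t w = Y t w}.

(* E^{y,e_i}: conditional expectation given alpha(0) = e_i.  The initial value
   y enters through the process Y^{u1,u2} started from y inside Z. *)
Definition cond_expectation (i : 'I_D) (Z : Omega -> \bar R) : \bar R :=
  (((fine (P [set w | chain X 0 w = i]))^-1)%:E *
   \int[P]_(w in [set w | chain X 0 w = i]) Z w)%E.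

Local Notation running := (R -> 'rV[R]_N -> 'I_D -> 'rV[R]_N -> 'rV[R]_N -> R).
Local Notation terminal := ('rV[R]_N -> 'I_D -> R).
Local Notation functional :=
  ('rV[R]_N -> 'I_D -> process -> process -> \bar R).

(* Ysol y u1 u2 is the solution Y^{u1,u2} with Y(0) = y. *)
Variable Ysol : 'rV[R]_N -> process -> process -> process.

Definition payoff (f : running) (g : terminal) : functional :=
  fun y i u1 u2 => cond_expectation i (fun w =>
    (\int[leb]_(t in `[0%R, T])
        (f t (Ysol y u1 u2 t w) (chain X t w) (u1 t w) (u2 t w))%:E
     + (g (Ysol y u1 u2 T w) (chain X T w))%:E)%E).

Definition lagrangian (f : running) (g Mk : terminal) (lam : R) : functional :=
  fun y i u1 u2 => cond_expectation i (fun w =>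
    (\int[leb]_(t in `[0%R, T])
        (f t (Ysol y u1 u2 t w) (chain X t w) (u1 t w) (u2 t w))%:E
     + (g (Ysol y u1 u2 T w) (chain X T w))%:E
     + (lam * Mk (Ysol y u1 u2 T w) (chain X T w))%:E)%E).

Definition constraint_value (Mk : terminal) : functional :=
  fun y i u1 u2 => cond_expectation i (fun w =>
    (Mk (Ysol y u1 u2 T w) (chain X T w))%:E).

(* E[int_0^T |f| dt + |g|] < oo, the first part being stated on the product
   space (Tonelli) together with the measurability that it presupposes. *)
Definition payoff_integrable (f : running) (g : terminal) (y : 'rV[R]_N)
    (u1 u2 : process) : Prop :=
  (leb \x P)%E.-integrable (`[0, T] `*` setT)
    (fun x => (f x.1 (Ysol y u1 u2 x.1 x.2) (chain X x.1 x.2)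
                 (u1 x.1 x.2) (u2 x.1 x.2))%:E) /\
  P.-integrable setT (fun w => (g (Ysol y u1 u2 T w) (chain X T w))%:E).

(* E[M_k(Y(T), alpha(T))] is well defined and < oo; it may be -oo. *)
Definition constraint_well_defined (Mk : terminal) (y : 'rV[R]_N)
    (u1 u2 : process) : Prop :=
  measurable_fun setT (fun w => Mk (Ysol y u1 u2 T w) (chain X T w)) /\
  (\int[P]_w (Num.max (Mk (Ysol y u1 u2 T w) (chain X T w)) 0)%:E < +oo)%E.

Definition running_C1 (U1 U2 : set 'rV[R]_N) (f : running) : Prop :=
  forall t i v1 v2, 0 <= t <= T -> U1 v1 -> U2 v2 ->
    class_C1 (fun y => f t y i v1 v2).

Definition terminal_C1 (g : terminal) : Prop :=
  forall i, class_C1 (g ^~ i).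

Section game.
Variables (G : set 'rV[R]_N) (Theta1 Theta2 : set process).

Definition is_nash (J1 J2 : functional) (u1 u2 : process) : Prop :=
  [/\ Theta1 u1, Theta2 u2 &
      forall y i, G y ->
        (forall v1, Theta1 v1 -> (J1 y i v1 u2 <= J1 y i u1 u2)%E) /\
        (forall v2, Theta2 v2 -> (J2 y i u1 v2 <= J2 y i u1 u2)%E)].

(* C1, C2 are the constraint functionals, required to vanish.  In the suprema
   at (y, e_i), the competitors have to satisfy the constraint at (y, e_i). *)
Definition solves_constrained_game (J1 J2 C1 C2 : functional)
    (u1 u2 : process) (phi1 phi2 : 'rV[R]_N -> 'I_D -> \bar R) : Prop :=
  [/\ Theta1 u1, Theta2 u2,
      forall y i, G y -> C1 y i u1 u2 = 0%E /\ C2 y i u1 u2 = 0%E &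
      forall y i, G y ->
        [/\ phi1 y i = J1 y i u1 u2,
            J1 y i u1 u2 = ereal_sup
              [set J1 y i v1 u2 | v1 in
                 [set v1 | Theta1 v1 /\ C1 y i v1 u2 = 0%E]],
            phi2 y i = J2 y i u1 u2 &
            J2 y i u1 u2 = ereal_sup
              [set J2 y i u1 v2 | v2 in
                 [set v2 | Theta2 v2 /\ C2 y i u1 v2 = 0%E]]]].

End game.

End noise.

(* Main.v *)
(* If the constraint expectation vanishes at a pair of controls, the multiplier
   term drops out of the Lagrangian, which then equals the payoff.  Hence a Nash
   equilibrium of the Lagrangian game that satisfies the constraints maximizes
   each player's payoff among the competitors that satisfy the constraint.
   Dropping the term rests on the linearity of the integral, hence on the
   integrability of each summand: for the running payoff by Fubini, and for M_k
   because E[M_k^+] < oo and E[M_k] = 0 exclude E[M_k^-] = oo. *)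

Require Import Defs.
From HB Require Import structures.
From mathcomp Require Import all_boot all_order all_algebra.
From mathcomp Require Import all_classical all_reals all_analysis.
From mathcomp Require Import measurable_realfun.

Set Implicit Arguments.
Unset Strict Implicit.
Unset Printing Implicit Defensive.

Import Order.TTheory GRing.Theory Num.Theory.
Import numFieldNormedType.Exports.

Local Open Scope classical_set_scope.
Local Open Scope ring_scope.

Section integrability.
Local Open Scope ereal_scope.

(** The integral is the difference of those of [f^\+] and [f^\-]. A difference in [\bar R] is finite
    only when both terms are, so the negative part has finite integral too, and [|f|] is the sum of
    the two parts. *)
Lemma integrable_of_funepos d (T : measurableType d) (R : realType)
    (mu : {measure set T -> \bar R}) (D : set T) (f : T -> \bar R) :
  measurable D -> measurable_fun D f ->
  \int[mu]_(x in D) f^\+ x < +oo -> \int[mu]_(x in D) f x \is a fin_num ->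
  mu.-integrable D f.
Proof.
move=> mD mf fpos; rewrite integralE => ffin.
have pos_fin : \int[mu]_(x in D) f^\+ x \is a fin_num.
  by rewrite ge0_fin_numE //; apply: integral_ge0.
have neg_fin : \int[mu]_(x in D) f^\- x \is a fin_num.
  by move: ffin; rewrite fin_numB => /andP[].
apply/integrableP; split=> //.
under eq_integral do rewrite -/((abse \o f) _) fune_abse.
rewrite ge0_integralD //; [|exact: measurable_funepos|exact: measurable_funeneg].
by rewrite lte_add_pinfty // ltey_eq neg_fin.
Qed.

Context d1 d2 (T1 : measurableType d1) (T2 : measurableType d2) (R : realType).
Variables (m1 : {sigma_finite_measure set T1 -> \bar R})
          (m2 : {sigma_finite_measure set T2 -> \bar R}).

(** The modulus of a partial integral is at most the partial integral of [|f|], and integrating the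
    latter against [m2] gives a finite value by Tonelli. *)
Lemma integrable_fubini_G (f : T1 * T2 -> \bar R) :
  (m1 \x m2).-integrable setT f -> m2.-integrable setT (fubini_G m1 f).
Proof.
move=> fi; have mf := measurable_int _ fi.
apply/integrableP; split; first exact: measurable_fubini_G fi.
apply: le_lt_trans ((integrable21ltyP m1 m2 mf).1 fi).
apply: ge0_le_integral => //.
- by apply: measurableT_comp => //; exact: measurable_fubini_G fi.
- apply: (measurable_fun_fubini_tonelli_G (abse \o f)) => [|z].
    exact: measurableT_comp.
  exact: abse_ge0.
- by move=> y _; apply: le_abse_integral => //; exact: measurableT_comp.
Qed.

(** Extension by zero off the strip [D] x [T2] reduces this to the full product. With [D] the time
    interval and [m2] the probability, it yields integrability of the running payoff in [w]. *)
Lemma integrable_integral_section (D : set T1) (f : T1 * T2 -> \bar R) :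
  measurable D -> (m1 \x m2).-integrable (D `*` setT) f ->
  m2.-integrable setT (fun y => \int[m1]_(x in D) f (x, y)).
Proof.
move=> mD; rewrite integrable_mkcond; last exact: measurableX.
move=> /integrable_fubini_G; congr (m2.-integrable _ _).
apply/funext => y; rewrite /fubini_G [RHS]integral_mkcond.
apply: eq_integral => x _; rewrite !patchE.
by have [xD|xD] := boolP (x \in D); rewrite in_setX /= ?xD ?(negbTE xD) ?in_setT.
Qed.

End integrability.

(** [Jlam] and [J] are compared only at feasible points, and [u] is one of them: maximality of
    [Jlam] at [u] over all of [A] thus passes to [J] on the feasible set. *)
Lemma constrained_sup_attained (R : realType) (U : Type) (A : set U)
    (Jlam J C : U -> \bar R) (u : U) :
  (forall v, A v -> C v = 0%E -> Jlam v = J v) ->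
  A u -> C u = 0%E ->
  (forall v, A v -> (Jlam v <= Jlam u)%E) ->
  J u = ereal_sup [set J v | v in [set v | A v /\ C v = 0%E]].
Proof.
move=> JE Au Cu umax; apply/eqP; rewrite eq_le; apply/andP; split.
  by apply: ereal_sup_ubound; exists u.
apply: ge_ereal_sup => _ [v [Av Cv] <-].
by rewrite -JE // -(JE u) //; exact: umax.
Qed.

Lemma lagrangian_payoff d (Omega : measurableType d) (R : realType)
    (P : probability Omega R) (T : R) (N M L D : nat)
    (X : @noise d Omega R M L D)
    (Y : 'rV[R]_N -> (R -> Omega -> 'rV[R]_N) -> (R -> Omega -> 'rV[R]_N) ->
         R -> Omega -> 'rV[R]_N)
    (f : R -> 'rV[R]_N -> 'I_D -> 'rV[R]_N -> 'rV[R]_N -> R)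
    (g Mk : 'rV[R]_N -> 'I_D -> R) (lam : R) y i u1 u2 :
  measurable [set w | chain X 0 w = i] ->
  (0 < P [set w | chain X 0 w = i])%E ->
  payoff_integrable P T X Y f g y u1 u2 ->
  constraint_well_defined P T X Y Mk y u1 u2 ->
  constraint_value P T X Y Mk y i u1 u2 = 0%E ->
  lagrangian P T X Y f g Mk lam y i u1 u2 = payoff P T X Y f g y i u1 u2.
Proof.
rewrite /lagrangian /payoff /constraint_value /cond_expectation.
set E := [set w | _] => mE PE [fint gint] [mMk Mkpos] /eqP.
have PE_fin : P E \is a fin_num by exact: fin_num_measure.
(* The normalising factor of the conditional expectation is nonzero, so the constraint says that the
   plain integral of [Mk] over [E] vanishes. *)
have invPE : ((fine (P E))^-1)%:E != 0%E.
  by rewrite eqe invr_eq0 gt_eqF // fine_gt0 // PE -ge0_fin_numE.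
rewrite mule_eq0 (negbTE invPE) /= => /eqP IMk.
congr (_ * _)%E.
have sE : E `<=` setT by [].
have Mkint : P.-integrable E (fun w => (Mk (Y y u1 u2 T w) (chain X T w))%:E).
  set h := fun w => (Mk _ _)%:E.
  have mh : measurable_fun setT h by exact/measurable_EFinP.
  apply: integrable_of_funepos => //; last by rewrite IMk.
    exact: measurable_funS mh.
  apply: le_lt_trans Mkpos.
  (* The bound on the positive part is known over all of [Omega]; nonnegativity carries it to
     [E]. *)
  under [leRHS]eq_integral do rewrite EFin_max -/(h _) -(funeposE h).
  by apply: ge0_subset_integral => //; exact: measurable_funepos.
have Fint : P.-integrable E (fun w => \int[lebesgue_measure]_(t in `[0%R, T])
    (f t (Y y u1 u2 t w) (chain X t w) (u1 t w) (u2 t w))%:E)%E.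
  apply: (integrableS measurableT mE sE).
  exact: (integrable_integral_section _ fint).
have gintE := integrableS measurableT mE sE gint.
rewrite integralD //; [|exact: integrableD|exact: (integrableZl mE lam Mkint)].
by rewrite [X in (_ + X)%E](integralZl mE Mkint lam) IMk mule0 adde0.
Qed.

Theorem theorem4p3 (d : measure_display) (Omega : measurableType d)
  (R : realType) (P : probability Omega R) (T : R) (N M L D : nat)
  (X : @noise d Omega R M L D)
  (S : @dynamics R M L D N)
  (G U1 U2 : set 'rV[R]_N)
  (Theta1 Theta2 : set (R -> Omega -> 'rV[R]_N))
  (Y : 'rV[R]_N -> (R -> Omega -> 'rV[R]_N) -> (R -> Omega -> 'rV[R]_N) ->
       R -> Omega -> 'rV[R]_N)
  (f1 f2 : R -> 'rV[R]_N -> 'I_D -> 'rV[R]_N -> 'rV[R]_N -> R)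
  (g1 g2 M1 M2 : 'rV[R]_N -> 'I_D -> R)
  (A1 A2 : set R)
  (u1s u2s : R -> R -> R -> Omega -> 'rV[R]_N)
  (phi1 phi2 : R -> R -> 'rV[R]_N -> 'I_D -> \bar R)
  (lam1_0 lam2_0 : R) :
  0 < T ->
  is_noise P T X ->
  open G -> U1 !=set0 -> U2 !=set0 ->
  measurable_dynamics T U1 U2 S ->
  running_C1 T U1 U2 f1 -> running_C1 T U1 U2 f2 ->
  terminal_C1 g1 -> terminal_C1 g2 ->
  terminal_C1 M1 -> terminal_C1 M2 ->
  (forall u1, Theta1 u1 -> admissible_control P T X U1 u1) ->
  (forall u2, Theta2 u2 -> admissible_control P T X U2 u2) ->
  (forall y u1 u2, G y -> Theta1 u1 -> Theta2 u2 ->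
    [/\ unique_strong_solution P T X S u1 u2 y (Y y u1 u2),
        payoff_integrable P T X Y f1 g1 y u1 u2,
        payoff_integrable P T X Y f2 g2 y u1 u2,
        constraint_well_defined P T X Y M1 y u1 u2 &
        constraint_well_defined P T X Y M2 y u1 u2]) ->
  (forall lam1 lam2, A1 lam1 -> A2 lam2 ->
    is_nash G Theta1 Theta2
      (lagrangian P T X Y f1 g1 M1 lam1) (lagrangian P T X Y f2 g2 M2 lam2)
      (u1s lam1 lam2) (u2s lam1 lam2)) ->
  (forall lam1 lam2 y i, A1 lam1 -> A2 lam2 -> G y ->
    phi1 lam1 lam2 y i =
      lagrangian P T X Y f1 g1 M1 lam1 y i (u1s lam1 lam2) (u2s lam1 lam2) /\
    phi2 lam1 lam2 y i =
      lagrangian P T X Y f2 g2 M2 lam2 y i (u1s lam1 lam2) (u2s lam1 lam2)) ->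
  A1 lam1_0 -> A2 lam2_0 ->
  (forall lam1 lam2 y i, A1 lam1 -> A2 lam2 -> G y ->
    constraint_value P T X Y M1 y i (u1s lam1_0 lam2) (u2s lam1_0 lam2) = 0%E /\
    constraint_value P T X Y M2 y i (u1s lam1 lam2_0) (u2s lam1 lam2_0) = 0%E) ->
  solves_constrained_game G Theta1 Theta2
    (payoff P T X Y f1 g1) (payoff P T X Y f2 g2)
    (constraint_value P T X Y M1) (constraint_value P T X Y M2)
    (u1s lam1_0 lam2_0) (u2s lam1_0 lam2_0)
    (phi1 lam1_0 lam2_0) (phi2 lam1_0 lam2_0).
Proof.
move=> _ [_ _ _ [mchain _ _ _ _] chain_gt0] _ _ _ _ _ _ _ _ _ _ _ _ adm nash phiE
  A10 A20 vanish.
have [Th1 Th2 opt] := nash _ _ A10 A20.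
split=> //.
  (* At [(lam1_0, lam2_0)] the two families of constraint identities concern the same pair of
     controls. *)
  by move=> y i Gy; exact: vanish.
move=> y i Gy.
have [C1 C2] := vanish lam1_0 lam2_0 y i A10 A20 Gy.
have [max1 max2] := opt y i Gy.
have [-> ->] := phiE lam1_0 lam2_0 y i A10 A20 Gy.
(* The opponent's control stays frozen, and [adm] supplies the integrability along the state process
   of the deviating pair. *)
have E1 v : Theta1 v ->
    constraint_value P T X Y M1 y i v (u2s lam1_0 lam2_0) = 0%E ->
    lagrangian P T X Y f1 g1 M1 lam1_0 y i v (u2s lam1_0 lam2_0) =
    payoff P T X Y f1 g1 y i v (u2s lam1_0 lam2_0).
  by move=> Thv; have [_ ? _ ? _] := adm y v _ Gy Thv Th2; exact: lagrangian_payoff.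
have E2 v : Theta2 v ->
    constraint_value P T X Y M2 y i (u1s lam1_0 lam2_0) v = 0%E ->
    lagrangian P T X Y f2 g2 M2 lam2_0 y i (u1s lam1_0 lam2_0) v =
    payoff P T X Y f2 g2 y i (u1s lam1_0 lam2_0) v.
  by move=> Thv; have [_ _ ? _ ?] := adm y _ v Gy Th1 Thv; exact: lagrangian_payoff.
split; [exact: E1| |exact: E2|].
- exact: (constrained_sup_attained E1 Th1 C1 max1).
- exact: (constrained_sup_attained E2 Th2 C2 max2).
Qed.
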